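(* Let $\Phi\subseteq\{I,O,U,\mathit{Self},Q_n,N_n\mid n\in\mathbb N\setminus\{0\}\}$ and let $\mathcal A$ be a fuzzy ABox in $\mathcal L_\Phi$. Suppose that $O\in\Phi$ or that $\mathcal A$ consists only of fuzzy assertions of the form $C(a)\bowtie p$. Then for all fuzzy interpretations $\mathcal I$ and $\mathcal I'$ that are witnessed w.r.t. $\mathcal L_\Phi$ and $\Phi$-bisimilar to each other, $\mathcal I\models\mathcal A$ iff $\mathcal I'\models\mathcal A$.
   Context: Gödel operations on $[0,1]$: $p\otimes q=\min\{p,q\}$, $p\oplus q=\max\{p,q\}$, $\ominus p=1$ if $p=0$ and $0$ otherwise, $(p\Rightarrow q)=1$ if $p\le q$ and $q$ otherwise, $(p\Leftrightarrow q)=(p\Rightarrow q)\otimes(q\Rightarrow p)$. Fix pairwise disjoint sets $\mathsf{CN}$, $\mathsf{RN}$, $\mathsf{IN}$ of concept, role and individual names. A basic role w.r.t. $\Phi$ is $r\in\mathsf{RN}$, or $r^-$ when $I\in\Phi$. Roles and concepts of $\mathcal L_\Phi$: each $r\in\mathsf{RN}$ is a role; if $R,S$ are roles and $C$ a concept then $R\circ S$, $R\sqcup S$, $R^*$, $C?$ are roles; $R^-$ if $I\in\Phi$; $U$ if $U\in\Phi$; concepts: $p\in[0,1]$, $A\in\mathsf{CN}$, $C\sqcap D$, $C\to D$, $\neg C$, $C\sqcup D$, $\forall R.C$, $\exists R.C$; $\{a\}$ ($a\in\mathsf{IN}$) if $O\in\Phi$; $\exists r.\mathit{Self}$ if $\mathit{Self}\in\Phi$;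 ${\ge}n\,R.C$, ${<}n\,R.C$ for basic $R$ if $Q_n\in\Phi$; ${\ge}n\,R$, ${<}n\,R$ for basic $R$ if $N_n\in\Phi$. $\top$ is concept $1$. A fuzzy interpretation $\mathcal I$ has a nonempty domain $\Delta^{\mathcal I}$, $a^{\mathcal I}\in\Delta^{\mathcal I}$, $A^{\mathcal I}:\Delta^{\mathcal I}\to[0,1]$, $r^{\mathcal I}:(\Delta^{\mathcal I})^2\to[0,1]$, extended by: $U^{\mathcal I}\equiv1$; $(R^-)^{\mathcal I}(x,y)=R^{\mathcal I}(y,x)$; $(C?)^{\mathcal I}(x,y)=C^{\mathcal I}(x)$ if $x=y$, else $0$; $(R\circ S)^{\mathcal I}(x,y)=\sup_z R^{\mathcal I}(x,z)\otimes S^{\mathcal I}(z,y)$; $(R\sqcup S)^{\mathcal I}=R^{\mathcal I}\oplus S^{\mathcal I}$; $(R^* )^{\mathcal I}(x,y)=\sup\{\min(\{1\}\cup\{R^{\mathcal I}(x_i,x_{i+1})\mid i<n\})\mid n\ge0,x_0=x,x_n=y\}$; $p^{\mathcal I}(x)=p$; $\{a\}^{\mathcal I}(x)=1$ iff $x=a^{\mathcal I}$, else $0$; $(\neg C)^{\mathcal I}=\ominus C^{\mathcal I}$; $\sqcap,\sqcup,\to$ pointwise by $\otimes,\oplus,\Rightarrow$; $(\exists r.\mathit{Self})^{\mathcal I}(x)=r^{\mathcal I}(x,x)$; $(\exists R.C)^{\mathcal I}(x)=\sup_y R^{\mathcal I}(x,y)\otimes C^{\mathcal I}(y)$; $(\forall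 R.C)^{\mathcal I}(x)=\inf_y(R^{\mathcal I}(x,y)\Rightarrow C^{\mathcal I}(y))$; $({\ge}n\,R.C)^{\mathcal I}(x)=\sup\{\min_i(R^{\mathcal I}(x,y_i)\otimes C^{\mathcal I}(y_i))\mid y_1..y_n$ pairwise distinct$\}$; $({<}n\,R.C)^{\mathcal I}(x)=\inf\{\min_i(R^{\mathcal I}(x,y_i)\otimes C^{\mathcal I}(y_i))\Rightarrow e\mid y_1..y_n\}$ with $e=1$ if some $y_j=y_k$ ($j<k$), else $0$; ${\ge}n\,R={\ge}n\,R.\top$, ${<}n\,R={<}n\,R.\top$. Witnessed w.r.t. $\mathcal L_\Phi$: for roles/concepts of $\mathcal L_\Phi$, every infinite set whose infimum (supremum) is taken above has a least (greatest) element. A fuzzy assertion in $\mathcal L_\Phi$ is $a\doteq b$, $a\not\doteq b$, $C(a)\bowtie p$ or $R(a,b)\bowtie p$ ($a,b\in\mathsf{IN}$, $C$ a concept and $R$ a role of $\mathcal L_\Phi$, $\bowtie\in\{\ge,>,\le,<\}$, $p\in[0,1]$), validated by $\mathcal I$ iff respectively $a^{\mathcal I}=b^{\mathcal I}$, $a^{\mathcal I}\ne b^{\mathcal I}$, $C^{\mathcal I}(a^{\mathcal I})\bowtie p$, $R^{\mathcal I}(a^{\mathcal I},b^{\mathcal I})\bowtie p$. A fuzzy ABox is a finite set of fuzzy assertions; $\mathcal I\models\mathcal A$ iff $\mathcal I$ validates all of them. A fuzzy $\Phi$-bisimulation between $\mathcal I,\mathcal I'$ is $Z:\Delta^{\mathcal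 I}\times\Delta^{\mathcal I'}\to[0,1]$ with, for all $x,x',A,a,r$ and basic $R$: (i) $Z(x,x')\le(A^{\mathcal I}(x)\Leftrightarrow A^{\mathcal I'}(x'))$; (ii) $\forall y\exists y'$: $Z(x,x')\otimes R^{\mathcal I}(x,y)\le Z(y,y')\otimes R^{\mathcal I'}(x',y')$; (iii) $\forall y'\exists y$: $Z(x,x')\otimes R^{\mathcal I'}(x',y')\le Z(y,y')\otimes R^{\mathcal I}(x,y)$; (iv) if $O\in\Phi$: $Z(x,x')=0$ whenever exactly one of $x=a^{\mathcal I}$, $x'=a^{\mathcal I'}$ holds; (v) if $U\in\Phi$: $\forall y\exists y'$ $Z(x,x')\le Z(y,y')$ and $\forall y'\exists y$ $Z(x,x')\le Z(y,y')$; (vi) if $\mathit{Self}\in\Phi$: $Z(x,x')\le(r^{\mathcal I}(x,x)\Leftrightarrow r^{\mathcal I'}(x',x'))$; (vii) if $Q_n\in\Phi$: if $Z(x,x')>0$ and $y_1..y_n$ pairwise distinct with all $R^{\mathcal I}(x,y_j)>0$, there exist pairwise distinct $y'_1..y'_n$ such that for each $i$ some $j$ has $Z(x,x')\otimes\bigotimes_k R^{\mathcal I}(x,y_k)\le Z(y_j,y'_i)\otimes R^{\mathcal I'}(x',y'_i)$, and symmetrically (from pairwise distinct $y'_1..y'_n$ with $R^{\mathcal I'}(x',y'_j)>0$ obtain pairwise distinct $y_1..y_n$ such that for each $i$ some $j$ has $Z(x,x')\otimes\bigotimes_k R^{\mathcal I'}(x',y'_k)\le Z(y_i,y'_j)\otimes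 R^{\mathcal I}(x,y_i)$); (viii) if $N_n\in\Phi$: as (vii) with right-hand sides $R^{\mathcal I'}(x',y'_i)$ for all $i$, resp. $R^{\mathcal I}(x,y_i)$ for all $i$. $\mathcal I$ and $\mathcal I'$ are $\Phi$-bisimilar if $\mathsf{IN}\ne\emptyset$ and there is a fuzzy $\Phi$-bisimulation $Z$ between them with $Z(a^{\mathcal I},a^{\mathcal I'})=1$ for all $a\in\mathsf{IN}$. *)

(* Defs.v *)
From mathcomp Require Import all_boot all_order all_algebra.
From mathcomp Require Import all_classical all_reals.

Set Implicit Arguments.
Unset Strict Implicit.
Unset Printing Implicit Defensive.

Import Order.TTheory GRing.Theory Num.Theory.
Local Open Scope classical_set_scope.
Local Open Scope ring_scope.

(* Truth values are elements of the real unit interval, represented as reals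
   together with bounds.  The Goedel t-norm and t-conorm are Num.min and
   Num.max. *)
Section Goedel.
Variable R : realType.
Implicit Types p q : R.

Definition gneg p : R := (p == 0)%:R.
Definition gimp p q : R := if p <= q then 1 else q.
Definition giff p q : R := Num.min (gimp p q) (gimp q p).

Definition has_greatest (A : set R) := exists2 m, A m & ubound A m.
Definition has_least (A : set R) := exists2 m, A m & lbound A m.

End Goedel.

Inductive feature : Type :=
| feat_I
| feat_O
| feat_U
| feat_Self
| feat_Q (n : nat) of (0 < n)%N
| feat_N (n : nat) of (0 < n)%N.

(* Basic roles, roles and concepts of the language determined by Phi: a
   constructor depending on a feature takes a proof that Phi contains it.
   Concept, role and individual names are elements of three separate types,
   hence pairwise disjoint. *)
Section Syntax.
Variables (R : realType) (CN RN IN : Type) (Phi : set feature).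

Inductive basic_role : Type :=
| BName (r : RN)
| BInv of Phi feat_I & RN.

Inductive role : Type :=
| RName (r : RN)
| RComp (r s : role)
| RUnion (r s : role)
| RStar (r : role)
| RTest (C : concept)
| RInv of Phi feat_I & role
| RUniv of Phi feat_U
with concept : Type :=
| CConst (p : R) of 0 <= p <= 1
| CName (A : CN)
| CAnd (C D : concept)
| CImp (C D : concept)
| CNeg (C : concept)
| COr (C D : concept)
| CAll (r : role) (C : concept)
| CEx (r : role) (C : concept)
| CNominal of Phi feat_O & IN
| CSelf of Phi feat_Self & RN
| CGeQ (n : nat) (n_gt0 : (0 < n)%N) of Phi (feat_Q n_gt0) &
    basic_role & concept
| CLtQ (n : nat) (n_gt0 : (0 < n)%N) of Phi (feat_Q n_gt0) &
    basic_role & concept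
| CGeN (n : nat) (n_gt0 : (0 < n)%N) of Phi (feat_N n_gt0) & basic_role
| CLtN (n : nat) (n_gt0 : (0 < n)%N) of Phi (feat_N n_gt0) & basic_role.

Inductive comparison : Type := Cge | Cgt | Cle | Clt.

Inductive assertion : Type :=
| AEq (a b : IN)
| ANeq (a b : IN)
| AConcept (C : concept) (a : IN) (op : comparison) (p : R) of 0 <= p <= 1
| ARole (r : role) (a b : IN) (op : comparison) (p : R) of 0 <= p <= 1.

Definition is_concept_assertion (phi : assertion) : bool :=
  if phi is AConcept _ _ _ _ _ then true else false.

End Syntax.

Record interpretation (R : realType) (CN RN IN : Type) := Interpretation {
  domain :> Type;
  domain_inhabited : inhabited domain;
  ind_val : IN -> domain;
  cname_val : CN -> domain -> R;
  cname_val01 : forall A x, 0 <= cname_val A x <= 1;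
  rname_val : RN -> domain -> domain -> R;
  rname_val01 : forall r x y, 0 <= rname_val r x y <= 1 }.

(* The sets of truth values whose supremum or infimum defines the semantics of
   the constructors.  As all values lie in the unit interval, 1 is the neutral
   element of the finite minima. *)
Section ValueSets.
Variables (R : realType) (D : Type).
Implicit Types (r s : D -> D -> R) (C : D -> R) (x y : D).

Definition comp_set r s x y : set R :=
  [set Num.min (r x z) (s z y) | z in [set: D]].

(* Only the values of u at 0, ..., n matter. *)
Definition star_set r x y : set R :=
  [set v | exists (n : nat) (u : nat -> D),
     [/\ u 0%N = x, u n = y & v = \big[Num.min/1]_(i < n) r (u i) (u i.+1)]].

Definition ex_set r C x : set R :=
  [set Num.min (r x y) (C y) | y in [set: D]].

Definition all_set r C x : set R :=
  [set gimp (r x y) (C y) | y in [set: D]].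

Definition ge_set n r C x : set R :=
  [set \big[Num.min/1]_(i < n) Num.min (r x (y i)) (C (y i))
  | y in [set y : 'I_n -> D | injective y]].

Definition lt_set n r C x : set R :=
  [set gimp (\big[Num.min/1]_(i < n) Num.min (r x (y i)) (C (y i)))
            (`[< exists j k : 'I_n, (j < k)%N /\ y j = y k >])%:R
  | y in [set: 'I_n -> D]].

End ValueSets.

Section Semantics.
Variables (R : realType) (CN RN IN : Type) (Phi : set feature).
Variable I : interpretation R CN RN IN.

Definition basic_val (r : basic_role RN Phi) (x y : I) : R :=
  match r with
  | BName r => rname_val r x y
  | BInv _ r => rname_val r y x
  end.

(* All suprema and infima below are over sets of reals included in the unit
   interval.  Only ge_set can be empty (when the domain has fewer than n
   elements); its supremum is then 0, in agreement with sup0. *)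
Fixpoint role_val (r : role R CN RN IN Phi) : I -> I -> R :=
  match r with
  | RName r => rname_val r
  | RComp r s => fun x y => sup (comp_set (role_val r) (role_val s) x y)
  | RUnion r s => fun x y => Num.max (role_val r x y) (role_val s x y)
  | RStar r => fun x y => sup (star_set (role_val r) x y)
  | RTest C => fun x y => if `[< x = y >] then concept_val C x else 0
  | RInv _ r => fun x y => role_val r y x
  | RUniv _ => fun _ _ => 1
  end
with concept_val (C : concept R CN RN IN Phi) : I -> R :=
  match C with
  | CConst p _ => fun _ => p
  | CName A => cname_val A
  | CAnd C D => fun x => Num.min (concept_val C x) (concept_val D x)
  | CImp C D => fun x => gimp (concept_val C x) (concept_val D x)
  | CNeg C => fun x => gneg (concept_val C x)
  | COr C D => fun x => Num.max (concept_val C x) (concept_val D x)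
  | CAll r C => fun x => inf (all_set (role_val r) (concept_val C) x)
  | CEx r C => fun x => sup (ex_set (role_val r) (concept_val C) x)
  | CNominal _ a => fun x => (`[< x = ind_val I a >])%:R
  | CSelf _ r => fun x => rname_val r x x
  | CGeQ n _ _ r C => fun x => sup (ge_set n (basic_val r) (concept_val C) x)
  | CLtQ n _ _ r C => fun x => inf (lt_set n (basic_val r) (concept_val C) x)
  | CGeN n _ _ r => fun x => sup (ge_set n (basic_val r) (fun _ => 1) x)
  | CLtN n _ _ r => fun x => inf (lt_set n (basic_val r) (fun _ => 1) x)
  end.

Definition compare (op : comparison) (v p : R) : bool :=
  match op with
  | Cge => v >= p
  | Cgt => v > p
  | Cle => v <= p
  | Clt => v < p
  end.

Definition validates (phi : assertion R CN RN IN Phi) : Prop :=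
  match phi with
  | AEq a b => ind_val I a = ind_val I b
  | ANeq a b => ind_val I a <> ind_val I b
  | AConcept C a op p _ => compare op (concept_val C (ind_val I a)) p
  | ARole r a b op p _ =>
      compare op (role_val r (ind_val I a) (ind_val I b)) p
  end.

Definition models (A : set (assertion R CN RN IN Phi)) : Prop :=
  forall phi, A phi -> validates phi.

End Semantics.

Section Witnessed.
Variables (R : realType) (CN RN IN : Type) (Phi : set feature).
Variable I : interpretation R CN RN IN.
Implicit Types (r s : role R CN RN IN Phi) (C : concept R CN RN IN Phi).
Implicit Types (b : basic_role RN Phi) (x y : I).

Definition sup_witnessed (A : set R) := infinite_set A -> has_greatest A.
Definition inf_witnessed (A : set R) := infinite_set A -> has_least A.

Record witnessed : Prop := Witnessed {
  witnessed_comp : forall r s x y,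
    sup_witnessed (comp_set (role_val r) (role_val s) x y);
  witnessed_star : forall r x y, sup_witnessed (star_set (role_val r) x y);
  witnessed_ex : forall r C x,
    sup_witnessed (ex_set (role_val r) (concept_val C) x);
  witnessed_all : forall r C x,
    inf_witnessed (all_set (role_val r) (concept_val C) x);
  witnessed_geQ : forall n (n_gt0 : (0 < n)%N) b C x, Phi (feat_Q n_gt0) ->
    sup_witnessed (ge_set n (basic_val b) (concept_val C) x);
  witnessed_ltQ : forall n (n_gt0 : (0 < n)%N) b C x, Phi (feat_Q n_gt0) ->
    inf_witnessed (lt_set n (basic_val b) (concept_val C) x);
  witnessed_geN : forall n (n_gt0 : (0 < n)%N) b x, Phi (feat_N n_gt0) ->
    sup_witnessed (ge_set n (basic_val b) (fun _ => 1) x);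
  witnessed_ltN : forall n (n_gt0 : (0 < n)%N) b x, Phi (feat_N n_gt0) ->
    inf_witnessed (lt_set n (basic_val b) (fun _ => 1) x) }.

End Witnessed.

Section Bisimulation.
Variables (R : realType) (CN RN IN : Type) (Phi : set feature).
Variables I I' : interpretation R CN RN IN.
Implicit Types b : basic_role RN Phi.

Record bisimulation (Z : I -> I' -> R) : Prop := Bisimulation {
  bisim01 : forall x x', 0 <= Z x x' <= 1;
  bisim_cname : forall x x' A,
    Z x x' <= giff (cname_val A x) (cname_val A x');
  bisim_forth : forall (x : I) (x' : I') b (y : I), exists y' : I',
    Num.min (Z x x') (basic_val b x y)
      <= Num.min (Z y y') (basic_val b x' y');
  bisim_back : forall (x : I) (x' : I') b (y' : I'), exists y : I,
    Num.min (Z x x') (basic_val b x' y')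
      <= Num.min (Z y y') (basic_val b x y);
  bisim_O : Phi feat_O -> forall x x' a,
    (x = ind_val I a /\ x' <> ind_val I' a) \/
    (x <> ind_val I a /\ x' = ind_val I' a) -> Z x x' = 0;
  bisim_U_forth : Phi feat_U -> forall x x' y, exists y', Z x x' <= Z y y';
  bisim_U_back : Phi feat_U -> forall x x' y', exists y, Z x x' <= Z y y';
  bisim_Self : Phi feat_Self -> forall x x' r,
    Z x x' <= giff (rname_val r x x) (rname_val r x' x');
  bisim_Q_forth : forall n (n_gt0 : (0 < n)%N), Phi (feat_Q n_gt0) ->
    forall (x : I) (x' : I') b (y : 'I_n -> I),
      0 < Z x x' -> injective y -> (forall j, 0 < basic_val b x (y j)) ->
      exists2 y' : 'I_n -> I', injective y' &
        forall i, exists j,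
          Num.min (Z x x') (\big[Num.min/1]_(k < n) basic_val b x (y k))
            <= Num.min (Z (y j) (y' i)) (basic_val b x' (y' i));
  bisim_Q_back : forall n (n_gt0 : (0 < n)%N), Phi (feat_Q n_gt0) ->
    forall (x : I) (x' : I') b (y' : 'I_n -> I'),
      0 < Z x x' -> injective y' -> (forall j, 0 < basic_val b x' (y' j)) ->
      exists2 y : 'I_n -> I, injective y &
        forall i, exists j,
          Num.min (Z x x') (\big[Num.min/1]_(k < n) basic_val b x' (y' k))
            <= Num.min (Z (y i) (y' j)) (basic_val b x (y i));
  bisim_N_forth : forall n (n_gt0 : (0 < n)%N), Phi (feat_N n_gt0) ->
    forall (x : I) (x' : I') b (y : 'I_n -> I),
      0 < Z x x' -> injective y -> (forall j, 0 < basic_val b x (y j)) ->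
      exists2 y' : 'I_n -> I', injective y' &
        forall i,
          Num.min (Z x x') (\big[Num.min/1]_(k < n) basic_val b x (y k))
            <= basic_val b x' (y' i);
  bisim_N_back : forall n (n_gt0 : (0 < n)%N), Phi (feat_N n_gt0) ->
    forall (x : I) (x' : I') b (y' : 'I_n -> I'),
      0 < Z x x' -> injective y' -> (forall j, 0 < basic_val b x' (y' j)) ->
      exists2 y : 'I_n -> I, injective y &
        forall i,
          Num.min (Z x x') (\big[Num.min/1]_(k < n) basic_val b x' (y' k))
            <= basic_val b x (y i) }.

Definition bisimilar : Prop :=
  inhabited IN /\
  exists2 Z, bisimulation Z & forall a, Z (ind_val I a) (ind_val I' a) = 1.

End Bisimulation.

Arguments witnessed {R CN RN IN} Phi I.
Arguments bisimulation {R CN RN IN} Phi {I I'} Z.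
Arguments bisimilar {R CN RN IN} Phi I I'.

(* Main.v *)
Require Import Defs.
From mathcomp Require Import all_boot all_order all_algebra.
From mathcomp Require Import all_classical all_reals.
Local Open Scope classical_set_scope.

(** Pass to cuts: fix a threshold [w > 0] and read [w <= Z x x'],
    [w <= r x y], [w <= C x] as crisp relations.  A fuzzy bisimulation then
    becomes a crisp one for every [w], and invariance of concepts, together with
    the forth condition for complex roles, follows by a simultaneous induction
    as in the crisp case.  Witnessedness is what makes the cut of a supremum the
    union of the cuts; infima need nothing.  The back conditions come from
    the same induction applied to the transposed bisimulation. *)

Set Implicit Arguments.
Unset Strict Implicit.
Unset Printing Implicit Defensive.

Import Order.TTheory GRing.Theory Num.Theory.
Local Open Scope ring_scope.

Scheme role_concept_ind := Induction for role Sort Prop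
  with concept_role_ind := Induction for concept Sort Prop.
Combined Scheme role_concept_mutind from role_concept_ind, concept_role_ind.

(** * Suprema, infima and Gödel residua in the unit interval *)

Section UnitInterval.
Variable R : realType.
Implicit Types (A : set R) (p q w : R).

Definition unit_itv : set R := [set p | 0 <= p <= 1].

Lemma min01 p q : 0 <= p <= 1 -> 0 <= q <= 1 -> 0 <= Num.min p q <= 1.
Proof. by case: (leP p q). Qed.

Lemma max01 p q : 0 <= p <= 1 -> 0 <= q <= 1 -> 0 <= Num.max p q <= 1.
Proof. by case: (leP p q). Qed.

Lemma bool01 (b : bool) : 0 <= (b%:R : R) <= 1.
Proof. by case: b; rewrite ?lexx ler01. Qed.

Lemma gimp01 p q : 0 <= q <= 1 -> 0 <= gimp p q <= 1.
Proof. by rewrite /gimp; case: ifP => // _ _; rewrite ler01 lexx. Qed.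

Lemma bigmin01 (T : finType) (F : T -> R) :
  (forall i, 0 <= F i <= 1) -> 0 <= \big[Num.min/1]_i F i <= 1.
Proof.
move=> F01; rewrite bigmin_le_id andbT.
by apply/bigmin_geP; split=> // i _; case/andP: (F01 i).
Qed.

Lemma sup01 A : A `<=` unit_itv -> 0 <= sup A <= 1.
Proof.
move=> A01; have [->|/set0P[a Aa]] := eqVneq A set0.
  by rewrite sup0 lexx ler01.
have ubA : ubound A 1 by move=> b /A01 /andP[].
apply/andP; split; last by apply: ge_sup => //; exists a.
case/andP: (A01 _ Aa) => a0 _; apply: (le_trans a0).
by apply: ub_le_sup => //; exists 1.
Qed.

Lemma inf01 A : A `<=` unit_itv -> 0 <= inf A <= 1.
Proof.
move=> A01; have [->|/set0P[a Aa]] := eqVneq A set0.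
  by rewrite inf0 lexx ler01.
have lbA : lbound A 0 by move=> b /A01 /andP[].
apply/andP; split; first by apply: lb_le_inf => //; exists a.
by case/andP: (A01 _ Aa) => _; apply: le_trans; apply: ge_inf => //; exists 0.
Qed.

Lemma le_sup01 A a w : A `<=` unit_itv -> A a -> w <= a -> w <= sup A.
Proof.
move=> A01 Aa wa; apply: (le_trans wa); apply: ub_le_sup => //.
by exists 1 => b /A01 /andP[].
Qed.

Lemma inf01_ge A a w : A `<=` unit_itv -> w <= inf A -> A a -> w <= a.
Proof.
move=> A01 wA Aa; apply: (le_trans wA); apply: ge_inf => //.
by exists 0 => b /A01 /andP[].
Qed.

Lemma finite_has_greatest A : finite_set A -> A !=set0 -> has_greatest A.
Proof.
move=> /finite_seqP[s ->{A}]; elim: s => [[a]//|b s IHs] _.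
have [->|s_neq0] := eqVneq s [::].
  exists b => [|c] /=; first by rewrite inE.
  by rewrite inE => /eqP ->.
have /IHs[m /= ms ub_m] : [set` s] !=set0.
  by case: s s_neq0 {IHs} => // c s _; exists c; rewrite /= inE eqxx.
have [bm|mb] := leP b m.
  exists m => [|c] /=; first by rewrite inE ms orbT.
  by rewrite inE => /orP[/eqP ->//|]; exact: ub_m.
exists b => [|c] /=; first by rewrite inE eqxx.
by rewrite inE => /orP[/eqP ->//|/ub_m cm]; apply: le_trans cm (ltW mb).
Qed.

(** [0 < w] excludes the empty set, whose [sup] is 0 by convention. A finite nonempty set has a
    maximum anyway, an infinite one by witnessedness, so the supremum is attained. *)
Lemma le_sup_witnessed A w :
  0 < w -> sup_witnessed A -> w <= sup A -> exists2 a, A a & w <= a.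
Proof.
move=> w_gt0 witA wA; have [A0|/set0P A_neq0] := eqVneq A set0.
  by move: wA; rewrite A0 sup0 leNgt w_gt0.
have [m Am ub_m] : has_greatest A.
  have [/finite_has_greatest|] := pselect (finite_set A); first exact.
  exact: witA.
by exists m => //; apply: le_trans wA _; exact: ge_sup.
Qed.

(** Residuation in Kripke style. The smaller cuts [v] matter: if [q < p < w], the condition at [w]
    alone holds vacuously although [gimp p q = q < w]. *)
Lemma le_gimpP w p q : w <= 1 -> 0 <= q ->
  (w <= gimp p q) <-> (forall v, 0 < v -> v <= w -> v <= p -> v <= q).
Proof.
move=> w1 q0; rewrite /gimp; have [pq|qp] := leP p q; split=> //.
- by move=> _ v _ _ /le_trans; apply.
- by move=> wq v _ vw _; exact: le_trans wq.
move=> H; rewrite leNgt; apply/negP => qw.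
(* The refuting cut is [Num.min w p]: below [w] and [p], yet above [q], hence positive. *)
have qm : q < Num.min w p by rewrite lt_min qw qp.
have /H : 0 < Num.min w p by exact: le_lt_trans qm.
have [mw mp] : Num.min w p <= w /\ Num.min w p <= p.
  by rewrite !ge_min !lexx orbT.
by move=> /(_ mw mp); rewrite leNgt qm.
Qed.

Lemma le_gneg w p : 0 < w -> (w <= gneg p) = (w <= 1) && (p == 0).
Proof.
by rewrite /gneg; case: eqP => _ w0; rewrite ?andbT // andbF leNgt w0.
Qed.

End UnitInterval.

(** * The sets of truth values stay in the unit interval *)

Section ValueSetBounds.
Variables (R : realType) (D : Type) (r s : D -> D -> R) (C : D -> R).
Hypotheses (r01 : forall x y, 0 <= r x y <= 1)
  (s01 : forall x y, 0 <= s x y <= 1) (C01 : forall x, 0 <= C x <= 1).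

Lemma comp_set01 x y : comp_set r s x y `<=` @unit_itv R.
Proof. by move=> _ [z _ <-]; exact: min01. Qed.

Lemma star_set01 x y : star_set r x y `<=` @unit_itv R.
Proof. by move=> _ [n [u [_ _ ->]]]; exact: bigmin01. Qed.

Lemma ex_set01 x : ex_set r C x `<=` @unit_itv R.
Proof. by move=> _ [y _ <-]; exact: min01. Qed.

Lemma all_set01 x : all_set r C x `<=` @unit_itv R.
Proof. by move=> _ [y _ <-]; exact: gimp01. Qed.

Lemma ge_set01 n x : ge_set n r C x `<=` @unit_itv R.
Proof. by move=> _ [y _ <-]; apply: bigmin01 => i; exact: min01. Qed.

Lemma lt_set01 n x : lt_set n r C x `<=` @unit_itv R.
Proof. by move=> _ [y _ <-]; apply: gimp01; exact: bool01. Qed.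

End ValueSetBounds.

(** * Converses of compositions and iterations *)

Section Converse.
Variables (R : realType) (D : Type) (r s : D -> D -> R).

Lemma comp_set_conv x y :
  comp_set r s y x = comp_set (fun x y => s y x) (fun x y => r y x) x y.
Proof. by apply/seteqP; split=> _ [z _ <-]; exists z => //; rewrite minC. Qed.

Lemma star_set_conv x y : star_set r y x = star_set (fun x y => r y x) x y.
Proof.
(* Traverse the path backwards. Stating this for arbitrary [q] yields both inclusions, as the
   converse of the converse of [r] is [r]. *)
have sub (q : D -> D -> R) a b :
    star_set q b a `<=` star_set (fun x y => q y x) a b.
  move=> _ [n [u [u0 un ->]]]; exists n, (fun i => u (n - i)%N).
  rewrite subn0 subnn; split=> //.
  (* Edge [i] of the reversed path is edge [n - i.+1] of the original one. *)
  rewrite (reindex_inj rev_ord_inj) /=; apply: eq_bigr => i _.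
  by rewrite subnSK // subKn // ltnW.
by apply/seteqP; split; [exact: sub | exact: (sub (fun x y => r y x))].
Qed.

End Converse.

(** * Values of roles and concepts stay in the unit interval *)

Section Bounds.
Variables (R : realType) (CN RN IN : Type) (Phi : set feature).
Variable I : interpretation R CN RN IN.

Lemma basic_val01 (b : basic_role RN Phi) (x y : I) : 0 <= basic_val b x y <= 1.
Proof. by case: b => [r|? r] /=; exact: rname_val01. Qed.

Lemma role_concept_val01 :
  (forall (r : role R CN RN IN Phi) (x y : I), 0 <= role_val r x y <= 1) /\
  (forall (C : concept R CN RN IN Phi) (x : I), 0 <= concept_val C x <= 1).
Proof.
have one01 : 0 <= (1 : R) <= 1 by rewrite ler01 lexx.
apply: role_concept_mutind => /=.
- by move=> r x y; exact: rname_val01.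
- by move=> r r01 s s01 x y; apply/sup01/comp_set01.
- by move=> r r01 s s01 x y; exact: max01.
- by move=> r r01 x y; apply/sup01/star_set01.
- by move=> C C01 x y; case: ifP => // _; rewrite lexx ler01.
- by [].
- by [].
- by [].
- by move=> A x; exact: cname_val01.
- by move=> C C01 D D01 x; exact: min01.
- by move=> C C01 D D01 x; exact: gimp01.
- by move=> C C01 x; exact: bool01.
- by move=> C C01 D D01 x; exact: max01.
- by move=> r r01 C C01 x; apply/inf01/all_set01.
- by move=> r r01 C C01 x; apply/sup01/ex_set01.
- by move=> ? a x; exact: bool01.
- by move=> ? r x; exact: rname_val01.
- by move=> n n_gt0 ? b C C01 x; apply/sup01/ge_set01 => //; exact: basic_val01.
- by move=> n n_gt0 ? b C C01 x; apply/inf01/lt_set01 => //; exact: basic_val01.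
- by move=> n n_gt0 ? b x; apply/sup01/ge_set01 => //; exact: basic_val01.
- by move=> n n_gt0 ? b x; apply/inf01/lt_set01 => //; exact: basic_val01.
Qed.

Definition role_val01 := role_concept_val01.1.
Definition concept_val01 := role_concept_val01.2.

End Bounds.

(** * Constructors at a positive cut *)

Section Cuts.
Variables (R : realType) (D D' : Type) (Z : D -> D' -> R).

(** For nonnegative [C'] this amounts to [Num.min (Z x x') (C x) <= C' x']. *)
Definition preserved (C : D -> R) (C' : D' -> R) := forall w x x',
  0 < w -> w <= Z x x' -> w <= C x -> w <= C' x'.

Definition forth (r : D -> D -> R) (r' : D' -> D' -> R) := forall w x x' y,
  0 < w -> w <= Z x x' -> w <= r x y ->
  exists2 y', w <= Z y y' & w <= r' x' y'.

Hypothesis Z_le1 : forall x x', Z x x' <= 1.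

(** The attained supremum provides a midpoint. The cut does not decay over the two steps because the
    t-norm is the minimum. *)
Lemma forth_comp (r s : D -> D -> R) (r' s' : D' -> D' -> R) :
  (forall x y, 0 <= r' x y <= 1) -> (forall x y, 0 <= s' x y <= 1) ->
  (forall x y, sup_witnessed (comp_set r s x y)) ->
  forth r r' -> forth s s' ->
  forth (fun x y => sup (comp_set r s x y))
    (fun x y => sup (comp_set r' s' x y)).
Proof.
move=> r01 s01 wit fr fs w x x' y w0 wZ.
case/(le_sup_witnessed w0 (wit x y)) => _ [z _ <-].
rewrite le_min => /andP[wr ws].
have [z' wz wr'] := fr _ _ _ _ w0 wZ wr.
have [y' wy ws'] := fs _ _ _ _ w0 wz ws.
exists y' => //; apply: le_sup01; [exact: comp_set01 | by exists z' |].
by rewrite le_min wr'.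
Qed.

Lemma forth_union (r s : D -> D -> R) (r' s' : D' -> D' -> R) :
  forth r r' -> forth s s' ->
  forth (fun x y => Num.max (r x y) (s x y))
    (fun x y => Num.max (r' x y) (s' x y)).
Proof.
move=> fr fs w x x' y w0 wZ; rewrite le_max.
case/orP=> [/(fr _ _ _ _ w0 wZ)|/(fs _ _ _ _ w0 wZ)] [y' wy w'].
  by exists y'; rewrite // le_max w'.
by exists y'; rewrite // le_max w' orbT.
Qed.

Lemma forth_path (r : D -> D -> R) (r' : D' -> D' -> R) w n (u : nat -> D) x' :
  forth r r' -> 0 < w -> w <= Z (u 0%N) x' ->
  (forall i, (i < n)%N -> w <= r (u i) (u i.+1)) ->
  exists u' : nat -> D', [/\ u' 0%N = x', w <= Z (u n) (u' n) &
    forall i, (i < n)%N -> w <= r' (u' i) (u' i.+1)].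
Proof.
move=> fr w0; elim: n u x' => [|n IHn] u x' wZ wr; first by exists (fun=> x').
have [y' wy wr'] := fr _ _ _ _ w0 wZ (wr 0%N isT).
have [u' [u'0 wn wu']] := IHn (fun i => u i.+1) y' wy (fun i => wr i.+1).
(* Prepend [x'] to the path found for the shifted sequence. *)
exists (fun i => if i is j.+1 then u' j else x'); split=> //.
by case=> [|i] ltin; [rewrite u'0 | exact: wu'].
Qed.

(** The attained supremum provides one finite path whose edges all reach [w]; [forth_path] copies it
    edge by edge. *)
Lemma forth_star (r : D -> D -> R) (r' : D' -> D' -> R) :
  (forall x y, 0 <= r' x y <= 1) ->
  (forall x y, sup_witnessed (star_set r x y)) ->
  forth r r' ->
  forth (fun x y => sup (star_set r x y)) (fun x y => sup (star_set r' x y)).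
Proof.
move=> r01 wit fr w x x' y w0 wZ.
case/(le_sup_witnessed w0 (wit x y)) => _ [n [u [u0 un ->]]] /bigmin_geP[w1 wr].
rewrite -u0 in wZ; have [|u' [u'0 wn wr']] := forth_path (n := n) fr w0 wZ.
  by move=> i ltin; exact: (wr (Ordinal ltin)).
exists (u' n); first by rewrite -un.
apply: le_sup01; [exact: star_set01 | by exists n, u' |].
by apply/bigmin_geP; split=> // i _; exact: wr'.
Qed.

(** Implication is contravariant in [C], so [C] has to be reflected. By [le_gimpP] the argument runs
    at every cut [v <= w], where the two points are still related. *)
Lemma preserved_imp (C E : D -> R) (C' E' : D' -> R) :
  (forall x, 0 <= E x) -> (forall x, 0 <= E' x) ->
  (forall w x x', 0 < w -> w <= Z x x' -> w <= C' x' -> w <= C x) ->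
  preserved E E' ->
  preserved (fun x => gimp (C x) (E x)) (fun x => gimp (C' x) (E' x)).
Proof.
move=> E0 E'0 pC pE w x x' w0 wZ; have w1 := le_trans wZ (Z_le1 x x').
move=> /le_gimpP H; apply/le_gimpP => // v v0 vw vC.
have vZ := le_trans vw wZ.
apply: (pE _ _ _ v0 vZ); apply: H => //; exact: (pC _ _ _ v0 vZ).
Qed.

Lemma preserved_ex (r : D -> D -> R) (C : D -> R)
    (r' : D' -> D' -> R) (C' : D' -> R) :
  (forall x y, 0 <= r' x y <= 1) -> (forall x, 0 <= C' x <= 1) ->
  (forall x, sup_witnessed (ex_set r C x)) ->
  forth r r' -> preserved C C' ->
  preserved (fun x => sup (ex_set r C x)) (fun x => sup (ex_set r' C' x)).
Proof.
move=> r01 C01 wit fr pC w x x' w0 wZ.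
case/(le_sup_witnessed w0 (wit x)) => _ [y _ <-].
rewrite le_min => /andP[wr wC].
have [y' wy wr'] := fr _ _ _ _ w0 wZ wr.
apply: le_sup01; [exact: ex_set01 | by exists y' |].
by rewrite le_min wr' /= (pC _ _ _ w0 wy wC).
Qed.

Lemma preserved_all (r : D -> D -> R) (C : D -> R)
    (r' : D' -> D' -> R) (C' : D' -> R) :
  (forall x, 0 <= C x <= 1) -> (forall x, 0 <= C' x <= 1) ->
  (forall w x x' y', 0 < w -> w <= Z x x' -> w <= r' x' y' ->
     exists2 y, w <= Z y y' & w <= r x y) ->
  preserved C C' ->
  preserved (fun x => inf (all_set r C x)) (fun x => inf (all_set r' C' x)).
Proof.
move=> C01 C'01 br pC w x x' w0 wZ wA; have w1 := le_trans wZ (Z_le1 x x').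
(* The bound by [inf] requires a nonempty set; [x'] itself provides a member. *)
apply: lb_le_inf; first by exists (gimp (r' x' x') (C' x')), x'.
move=> _ [y' _ <-]; apply/le_gimpP => // [|v v0 vw vr'].
  by case/andP: (C'01 y').
have [y vy vr] := br _ _ _ _ v0 (le_trans vw wZ) vr'.
apply: (pC _ _ _ v0 vy).
have C0 : 0 <= C y by case/andP: (C01 y).
suff /le_gimpP : w <= gimp (r x y) (C y) by apply.
by apply: (inf01_ge _ wA); [exact: all_set01 | exists y].
Qed.

(** Shared by qualified and unqualified restrictions, the latter with [C] constantly 1; they differ
    only in how tuples are transferred. *)
Lemma sup_ge_set_le n (r : D -> D -> R) (C : D -> R)
    (r' : D' -> D' -> R) (C' : D' -> R) x x' w :
  (forall x y, 0 <= r' x y <= 1) -> (forall x, 0 <= C' x <= 1) ->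
  sup_witnessed (ge_set n r C x) -> 0 < w -> w <= 1 ->
  (forall y : 'I_n -> D, injective y ->
     (forall i, w <= r x (y i)) -> (forall i, w <= C (y i)) ->
     exists2 y' : 'I_n -> D', injective y' &
       forall i, w <= Num.min (r' x' (y' i)) (C' (y' i))) ->
  w <= sup (ge_set n r C x) -> w <= sup (ge_set n r' C' x').
Proof.
move=> r01 C01 wit w0 w1 H.
case/(le_sup_witnessed w0 wit) => _ [y y_inj <-] /bigmin_geP[_ wy].
have [||y' y'_inj wy'] := H y y_inj.
- by move=> i; have := wy i isT; rewrite le_min => /andP[].
- by move=> i; have := wy i isT; rewrite le_min => /andP[].
apply: le_sup01; [exact: ge_set01 | by exists y' |].
by apply/bigmin_geP; split.
Qed.

(** Tuples with a repetition contribute 1. An injective tuple reaching a positive cut [v <= w] in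
    [D'] would transfer to one in [D], where the implication to 0 would have value below [w]; hence
    tuples travel from [D'] to [D]. *)
Lemma inf_lt_set_le n (r : D -> D -> R) (C : D -> R)
    (r' : D' -> D' -> R) (C' : D' -> R) x x' w :
  w <= 1 ->
  (forall v (y' : 'I_n -> D'), 0 < v -> v <= w -> injective y' ->
     (forall i, v <= r' x' (y' i)) -> (forall i, v <= C' (y' i)) ->
     exists2 y : 'I_n -> D, injective y &
       forall i, v <= Num.min (r x (y i)) (C (y i))) ->
  w <= inf (lt_set n r C x) -> w <= inf (lt_set n r' C' x').
Proof.
move=> w1 H wA; apply: lb_le_inf.
  by eexists; exists (fun=> x').
move=> _ [y' _ <-]; apply/le_gimpP => // v v0 vw /bigmin_geP[v1 vy'].
case: asboolP => [//|no_rep]; exfalso.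
have y'_inj : injective y'.
  move=> j k eq_jk; apply: val_inj; case: (ltngtP j k) => // ltjk; case: no_rep.
    by exists j, k.
  by exists k, j.
have [||y y_inj vy] := H v y' v0 vw y'_inj.
- by move=> i; have := vy' i isT; rewrite le_min => /andP[].
- by move=> i; have := vy' i isT; rewrite le_min => /andP[].
(* Injectivity of [y] makes the consequent 0, so no positive cut up to [w] can reach the minimum. *)
have /(le_gimpP _ w1 (lexx 0)) vF :
    w <= gimp (\big[Num.min/1]_(i < n) Num.min (r x (y i)) (C (y i))) 0.
  apply: (inf01_ge _ wA); first exact: lt_set01.
  exists y => //; case: asboolP => // -[j [k [ltjk /y_inj eq_jk]]].
  by rewrite eq_jk ltnn in ltjk.
suff : v <= 0 by rewrite leNgt v0.
by apply: (vF v v0 vw); apply/bigmin_geP; split.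
Qed.

End Cuts.

(** * Invariance under bisimulations by simultaneous induction *)

Section Invariance.
Variables (R : realType) (CN RN IN : Type) (Phi : set feature).
Implicit Types (I : interpretation R CN RN IN).
Implicit Types (r : role R CN RN IN Phi) (C : concept R CN RN IN Phi).

Lemma bisimulation_sym I I' (Z : I -> I' -> R) :
  bisimulation Phi Z -> bisimulation Phi (fun x' x => Z x x').
Proof.
have giffC (p q : R) : giff p q = giff q p by rewrite /giff minC.
case=> b01 bA bf bb bO bUf bUb bS bQf bQb bNf bNb; split.
- by move=> x' x; exact: b01.
- by move=> x' x A; rewrite giffC; exact: bA.
- by move=> x' x; exact: bb.
- by move=> x' x; exact: bf.
- move=> Phi_O x' x a H; apply: (bO Phi_O x x' a).
  by case: H => -[? ?]; [right | left].
- by move=> Phi_U x' x y; exact: bUb.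
- by move=> Phi_U x' x y; exact: bUf.
- by move=> Phi_S x' x r; rewrite giffC; exact: bS.
- by move=> n n_gt0 Phi_Q x' x; exact: bQb.
- by move=> n n_gt0 Phi_Q x' x; exact: bQf.
- by move=> n n_gt0 Phi_N x' x; exact: bNb.
- by move=> n n_gt0 Phi_N x' x; exact: bNf.
Qed.

Lemma giff_cut (w z p q : R) :
  0 < w -> w <= z -> z <= 1 -> 0 <= q -> z <= giff p q -> w <= p -> w <= q.
Proof.
move=> w0 wz z1 q0; rewrite le_min => /andP[/(le_gimpP p z1 q0) H _].
exact: H.
Qed.

Lemma forth_basic I I' (Z : I -> I' -> R) (b : basic_role RN Phi) :
  bisimulation Phi Z -> forth Z (basic_val b) (basic_val b).
Proof.
move=> bZ w x x' y w0 wZ wb; have [y' Hy'] := bisim_forth bZ x x' b y.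
have : w <= Num.min (Z y y') (basic_val b x' y').
  by apply: le_trans Hy'; rewrite le_min wZ.
by rewrite le_min => /andP[wy wb']; exists y'.
Qed.

(** The matching of indices need not be a bijection: each [y' i] is related to some [y j], and every
    [y j] satisfies [C] at the cut. *)
Lemma Q_forth_cut I I' (Z : I -> I' -> R) (b : basic_role RN Phi)
    (C : I -> R) (C' : I' -> R) n (n_gt0 : (0 < n)%N) w x x' (y : 'I_n -> I) :
  bisimulation Phi Z -> Phi (feat_Q n_gt0) -> preserved Z C C' ->
  0 < w -> w <= Z x x' -> injective y ->
  (forall i, w <= basic_val b x (y i)) -> (forall i, w <= C (y i)) ->
  exists2 y' : 'I_n -> I', injective y' &
    forall i, w <= Num.min (basic_val b x' (y' i)) (C' (y' i)).
Proof.
move=> bZ Phi_Q pC w0 wZ y_inj wb wC; have [_ Z1] := andP (bisim01 bZ x x').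
have [|y' y'_inj Hy'] :=
  bisim_Q_forth bZ Phi_Q (b := b) (lt_le_trans w0 wZ) y_inj.
  by move=> j; exact: lt_le_trans w0 (wb j).
exists y' => // i; have [j Hj] := Hy' i.
have : w <= Num.min (Z (y j) (y' i)) (basic_val b x' (y' i)).
  apply: le_trans Hj; rewrite le_min wZ.
  by apply/bigmin_geP; split=> //; exact: le_trans wZ Z1.
by rewrite !le_min => /andP[wZj ->]; exact: (pC _ _ _ w0 wZj).
Qed.

Lemma N_forth_cut I I' (Z : I -> I' -> R) (b : basic_role RN Phi)
    n (n_gt0 : (0 < n)%N) w x x' (y : 'I_n -> I) :
  bisimulation Phi Z -> Phi (feat_N n_gt0) ->
  0 < w -> w <= Z x x' -> injective y ->
  (forall i, w <= basic_val b x (y i)) ->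
  exists2 y' : 'I_n -> I', injective y' &
    forall i, w <= Num.min (basic_val b x' (y' i)) 1.
Proof.
move=> bZ Phi_N w0 wZ y_inj wb; have [_ Z1] := andP (bisim01 bZ x x').
have w1 := le_trans wZ Z1.
have [|y' y'_inj Hy'] :=
  bisim_N_forth bZ Phi_N (b := b) (lt_le_trans w0 wZ) y_inj.
  by move=> j; exact: lt_le_trans w0 (wb j).
exists y' => // i; rewrite le_min w1 andbT; apply: le_trans (Hy' i).
by rewrite le_min wZ; apply/bigmin_geP; split.
Qed.

(* The statement for the converse role is needed because [RInv] applies to
   arbitrary roles, while bisimulations only constrain inverses of role
   names. *)
Definition role_forth r := forall I I' (Z : I -> I' -> R),
  bisimulation Phi Z -> witnessed Phi I -> witnessed Phi I' ->
  forth Z (role_val r) (role_val r) /\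
  (Phi feat_I ->
   forth Z (fun x y => role_val r y x) (fun x y => role_val r y x)).

(** The interpretations and [Z] are quantified inside, so that the induction hypothesis also applies
    to the transposed bisimulation. *)
Definition concept_preserved C := forall I I' (Z : I -> I' -> R),
  bisimulation Phi Z -> witnessed Phi I -> witnessed Phi I' ->
  preserved Z (concept_val C) (concept_val C).

Lemma concept_preserved_back C I I' (Z : I -> I' -> R) w x x' :
  concept_preserved C -> bisimulation Phi Z -> witnessed Phi I ->
  witnessed Phi I' -> 0 < w -> w <= Z x x' ->
  w <= concept_val C x' -> w <= concept_val C x.
Proof.
move=> pC /bisimulation_sym bZ wI wI' w0 wZ.
by apply: (pC _ _ _ bZ wI' wI).
Qed.

Lemma role_concept_invariance :
  (forall r, role_forth r) /\ (forall C, concept_preserved C).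
Proof.
apply: role_concept_mutind.
- move=> r I I' Z bZ wI wI'; split=> [|Phi_I].
    exact: (forth_basic (b := BName Phi r) bZ).
  exact: (forth_basic (b := BInv Phi_I r) bZ).
- move=> r IHr s IHs I I' Z bZ wI wI'.
  have [fr fri] := IHr _ _ _ bZ wI wI'; have [fs fsi] := IHs _ _ _ bZ wI wI'.
  split=> [|Phi_I].
    apply: forth_comp fr fs => *; [exact: role_val01 | exact: role_val01 |].
    exact: witnessed_comp.
  have [{}fri {}fsi] := (fri Phi_I, fsi Phi_I).
  (* The converse of a composition composes the converses in reverse order. *)
  have := @forth_comp _ _ _ Z _ _ _ _ _ _ _ fsi fri.
  have conv (J : interpretation R CN RN IN) :
      (fun x y : J => role_val (RComp r s) y x) =
      (fun x y => sup (comp_set (fun x y => role_val s y x)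
                         (fun x y => role_val r y x) x y)).
    by apply/funext => x; apply/funext => y /=; rewrite comp_set_conv.
  rewrite !conv; apply=> *; [exact: role_val01 | exact: role_val01 |].
  by rewrite -comp_set_conv; exact: witnessed_comp.
- move=> r IHr s IHs I I' Z bZ wI wI'.
  have [fr fri] := IHr _ _ _ bZ wI wI'; have [fs fsi] := IHs _ _ _ bZ wI wI'.
  by split=> [|Phi_I]; apply: forth_union => //; [exact: fri | exact: fsi].
- move=> r IHr I I' Z bZ wI wI'; have [fr fri] := IHr _ _ _ bZ wI wI'.
  split=> [|Phi_I].
    by apply: forth_star fr => *; [exact: role_val01 | exact: witnessed_star].
  have := @forth_star _ _ _ Z _ _ _ _ (fri Phi_I).
  have conv (J : interpretation R CN RN IN) :
      (fun x y : J => role_val (RStar r) y x) =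
      (fun x y => sup (star_set (fun x y => role_val r y x) x y)).
    by apply/funext => x; apply/funext => y /=; rewrite star_set_conv.
  rewrite !conv; apply=> *; first exact: role_val01.
  by rewrite -star_set_conv; exact: witnessed_star.
- move=> C IHC I I' Z bZ wI wI'; have pC := IHC _ _ _ bZ wI wI'.
  (* A positive cut excludes the value 0 off the diagonal, so [x = y] and [x'] is its own
     successor. *)
  split=> [|Phi_I] w x x' y w0 wZ /=;
    case: asboolP => [eq_xy wC|_]; rewrite ?leNgt ?w0 //.
    exists x'; [by rewrite -eq_xy | case: asboolP => // _].
    exact: (pC _ _ _ w0 wZ).
  exists x'; [by rewrite eq_xy | case: asboolP => // _].
  by apply: (pC _ _ _ w0 wZ); rewrite -eq_xy.
- move=> ? r IHr I I' Z bZ wI wI'; have [fr fri] := IHr _ _ _ bZ wI wI'.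
  (* Inversion exchanges the two halves of [role_forth]. *)
  by split=> [|_] //; exact: fri.
- move=> Phi_U I I' Z bZ wI wI'; split=> [|_] w x x' y w0 wZ w1;
    have [y' Zy] := bisim_U_forth bZ Phi_U x x' y;
    by exists y' => //; exact: le_trans Zy.
- by move=> p p01 I I' Z bZ wI wI' w x x'.
- move=> A I I' Z bZ wI wI' w x x' w0 wZ; have [_ Z1] := andP (bisim01 bZ x x').
  apply: giff_cut wZ Z1 _ (bisim_cname bZ x x' A) => //.
  by case/andP: (cname_val01 A x').
- move=> C IHC E IHE I I' Z bZ wI wI' w x x' w0 wZ /=.
  rewrite !le_min => /andP[wC wE].
  rewrite (IHC _ _ _ bZ wI wI' _ _ _ w0 wZ wC).
  by rewrite (IHE _ _ _ bZ wI wI' _ _ _ w0 wZ wE).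
- move=> C IHC E IHE I I' Z bZ wI wI'; apply: preserved_imp.
  + by move=> x x'; case/andP: (bisim01 bZ x x').
  + by move=> x; case/andP: (concept_val01 E x).
  + by move=> x; case/andP: (concept_val01 E x).
  + by move=> w x x'; exact: concept_preserved_back IHC bZ wI wI'.
  + exact: IHE.
- move=> C IHC I I' Z bZ wI wI' w x x' w0 wZ /=.
  rewrite !le_gneg // => /andP[-> /eqP C0] /=.
  have [C'0 _] := andP (concept_val01 C x').
  rewrite eq_le C'0 andbT leNgt; apply/negP => C'_gt0.
  (* If [C] were positive at [x'], reflecting it at this smaller cut would make it positive at
     [x]. *)
  have v0 : 0 < Num.min w (concept_val C x') by rewrite lt_min w0.
  have [vw vC'] : Num.min w (concept_val C x') <= w /\
      Num.min w (concept_val C x') <= concept_val C x'.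
    by rewrite !ge_min !lexx orbT.
  have := concept_preserved_back IHC bZ wI wI' v0 (le_trans vw wZ) vC'.
  by rewrite C0 leNgt v0.
- move=> C IHC E IHE I I' Z bZ wI wI' w x x' w0 wZ /=.
  rewrite !le_max => /orP[wC|wE].
    by rewrite (IHC _ _ _ bZ wI wI' _ _ _ w0 wZ wC).
  by rewrite (IHE _ _ _ bZ wI wI' _ _ _ w0 wZ wE) orbT.
- move=> r IHr C IHC I I' Z bZ wI wI'; apply: preserved_all.
  + by move=> x x'; case/andP: (bisim01 bZ x x').
  + by move=> x; exact: concept_val01.
  + by move=> x; exact: concept_val01.
  + move=> w x x' y' w0 wZ wr.
    (* The back condition for [r] is the forth condition of the transposed bisimulation. *)
    have [fr _] := IHr _ _ _ (bisimulation_sym bZ) wI' wI.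
    exact: (fr _ _ _ _ w0 wZ wr).
  + exact: IHC.
- move=> r IHr C IHC I I' Z bZ wI wI'; apply: preserved_ex.
  + by move=> x y; exact: role_val01.
  + by move=> x; exact: concept_val01.
  + by move=> x; exact: witnessed_ex.
  + exact: (IHr _ _ _ bZ wI wI').1.
  + exact: IHC.
- move=> Phi_O a I I' Z bZ wI wI' w x x' w0 wZ /=.
  case: asboolP => [xa|_]; last by rewrite leNgt w0.
  case: asboolP => // x'a.
  have Z0 := bisim_O bZ Phi_O (or_introl (conj xa x'a)).
  by move: wZ; rewrite Z0 leNgt w0.
- move=> Phi_S r I I' Z bZ wI wI' w x x' w0 wZ.
  have [_ Z1] := andP (bisim01 bZ x x').
  apply: giff_cut wZ Z1 _ (bisim_Self bZ Phi_S x x' r) => //.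
  by case/andP: (rname_val01 r x' x').
- move=> n n_gt0 Phi_Q b C IHC I I' Z bZ wI wI' w x x' w0 wZ.
  have [_ Z1] := andP (bisim01 bZ x x').
  apply: sup_ge_set_le => //.
  + by move=> ? ?; exact: basic_val01.
  + by move=> ?; exact: concept_val01.
  + exact: witnessed_geQ.
  + exact: le_trans wZ Z1.
  + by move=> y; exact: Q_forth_cut bZ Phi_Q (IHC _ _ _ bZ wI wI') w0 wZ.
- move=> n n_gt0 Phi_Q b C IHC I I' Z bZ wI wI' w x x' w0 wZ.
  have [_ Z1] := andP (bisim01 bZ x x').
  apply: inf_lt_set_le (le_trans wZ Z1) _ => v y' v0 vw.
  have bZ' := bisimulation_sym bZ.
  exact: Q_forth_cut bZ' Phi_Q (IHC _ _ _ bZ' wI' wI) v0 (le_trans vw wZ).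
- move=> n n_gt0 Phi_N b I I' Z bZ wI wI' w x x' w0 wZ.
  have [_ Z1] := andP (bisim01 bZ x x').
  apply: sup_ge_set_le => //.
  + by move=> ? ?; exact: basic_val01.
  + by move=> ?; rewrite ler01 lexx.
  + exact: witnessed_geN.
  + exact: le_trans wZ Z1.
  + by move=> y y_inj wb _; exact: N_forth_cut bZ Phi_N w0 wZ y_inj wb.
- move=> n n_gt0 Phi_N b I I' Z bZ wI wI' w x x' w0 wZ.
  have [_ Z1] := andP (bisim01 bZ x x').
  apply: inf_lt_set_le (le_trans wZ Z1) _ => v y' v0 vw y_inj vb _.
  exact: N_forth_cut (bisimulation_sym bZ) Phi_N v0 (le_trans vw wZ) y_inj vb.
Qed.

(** * From cuts to assertions about named individuals *)

Lemma bisimilar_sym I I' : bisimilar Phi I I' -> bisimilar Phi I' I.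
Proof.
case=> inhIN [Z bZ Z1]; split=> //.
by exists (fun x' x => Z x x') => //; exact: bisimulation_sym.
Qed.

(** Since [Z] is 1 at named individuals, the value of [C] itself can serve as the cut when it is
    positive. *)
Lemma bisimilar_concept_le C a I I' :
  witnessed Phi I -> witnessed Phi I' -> bisimilar Phi I I' ->
  concept_val C (ind_val I a) <= concept_val C (ind_val I' a).
Proof.
move=> wI wI' [_ [Z bZ Z1]].
have [C'0 _] := andP (concept_val01 C (ind_val I' a)).
have [C_gt0|/le_trans->//] := ltP 0 (concept_val C (ind_val I a)).
apply: (role_concept_invariance.2 C _ _ _ bZ wI wI' _ _ _ C_gt0) => //.
by rewrite Z1; case/andP: (concept_val01 C (ind_val I a)).
Qed.

(** Nominals let only the namesake be related to a named individual; this is what role and equality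
    assertions rely on. *)
Lemma bisim_ind_eq a I I' (Z : I -> I' -> R) (x' : I') :
  Phi feat_O -> bisimulation Phi Z -> 0 < Z (ind_val I a) x' ->
  x' = ind_val I' a.
Proof.
move=> Phi_O bZ Z0; have [//|x'a] := pselect (x' = ind_val I' a).
by move: Z0; rewrite (bisim_O bZ Phi_O (or_introl (conj erefl x'a))) ltxx.
Qed.

(** The forth condition only yields some successor [y']; nominals identify it with the
    interpretation of [b]. *)
Lemma bisimilar_role_le r a b I I' : Phi feat_O ->
  witnessed Phi I -> witnessed Phi I' -> bisimilar Phi I I' ->
  role_val r (ind_val I a) (ind_val I b)
    <= role_val r (ind_val I' a) (ind_val I' b).
Proof.
move=> Phi_O wI wI' [_ [Z bZ Z1]].
have [r'0 _] := andP (role_val01 r (ind_val I' a) (ind_val I' b)).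
have [r_gt0|/le_trans->//] := ltP 0 (role_val r (ind_val I a) (ind_val I b)).
have [fr _] := role_concept_invariance.1 r _ _ _ bZ wI wI'.
have [|y' wy wr] := fr _ _ (ind_val I' a) _ r_gt0 _ (lexx _).
  by rewrite Z1; case/andP: (role_val01 r (ind_val I a) (ind_val I b)).
by rewrite -(bisim_ind_eq Phi_O bZ (lt_le_trans r_gt0 wy)).
Qed.

Lemma bisimilar_eq a b I I' : Phi feat_O -> bisimilar Phi I I' ->
  ind_val I a = ind_val I b -> ind_val I' a = ind_val I' b.
Proof.
move=> Phi_O [_ [Z bZ Z1]] eq_ab.
by apply: (bisim_ind_eq Phi_O bZ); rewrite -eq_ab Z1.
Qed.

(** The inequalities in both directions make the values equal, so every comparison, including [Cle]
    and [Clt], is preserved. *)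
Lemma bisimilar_models (A : set (assertion R CN RN IN Phi)) I I' :
  Phi feat_O \/ (forall phi, A phi -> is_concept_assertion phi) ->
  witnessed Phi I -> witnessed Phi I' -> bisimilar Phi I I' ->
  models I A -> models I' A.
Proof.
move=> hA wI wI' bis mA phi Aphi; have bis' := bisimilar_sym bis.
have Phi_O : ~~ is_concept_assertion phi -> Phi feat_O.
  by case: hA => // /(_ _ Aphi) ->.
case: phi Aphi Phi_O => [a b|a b|C a op p p01|r a b op p p01] /mA /= Iphi Phi_O.
- exact: bisimilar_eq (Phi_O isT) bis Iphi.
(* By contraposition: an equality in [I'] would transfer back to [I]. *)
- by move=> /(bisimilar_eq (Phi_O isT) bis').
- suff -> : concept_val C (ind_val I' a) = concept_val C (ind_val I a) by [].
  by apply/le_anti; rewrite !bisimilar_concept_le.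
- suff -> : role_val r (ind_val I' a) (ind_val I' b) =
      role_val r (ind_val I a) (ind_val I b) by [].
  by apply/le_anti; rewrite !bisimilar_role_le //; exact: Phi_O.
Qed.

End Invariance.

Theorem theorem3 (R : realType) (CN RN IN : Type) (Phi : set feature)
    (A : set (assertion R CN RN IN Phi)) (finA : finite_set A)
    (hA : Phi feat_O \/ forall phi, A phi -> is_concept_assertion phi)
    (I I' : interpretation R CN RN IN) :
  witnessed Phi I -> witnessed Phi I' -> bisimilar Phi I I' ->
  models I A <-> models I' A.
Proof.
move=> wI wI' bis; split; apply: bisimilar_models => //.
exact: bisimilar_sym.
Qed.
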